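(* Fix $H$ and $\Lambda=\{\lambda_i:i\in V(H)\}$, and suppose that $\lambda_i>1$ for all $i \in V(H)$. Let $G$ be any bipartite graph with bipartition classes $\mathcal{E}$ and $\mathcal{O}$, where $|\mathcal{O}|\geq |\mathcal{E}|$, and let $d$ be an arbitrary positive integer. Then $$Z_\Lambda(G,H) \leq w_\Lambda(H)^{|\{w \in \mathcal{E}:d(w)< d\}|} \prod_{v \in \mathcal{O}} Z_\Lambda(K_{d(v),d},H)^{1/d}.$$
   Context: $G=(V(G),E(G))$ is a simple, loopless, finite graph; $H$ is a finite graph without multiple edges but perhaps with loops; $\Lambda=\{\lambda_i : i\in V(H)\}$ is a set of positive real weights indexed by the vertices of $H$. ${\rm Hom}(G,H)$ is the set of functions $f:V(G)\to V(H)$ such that $uv\in E(G)$ implies $f(u)f(v)\in E(H)$. Put $w_\Lambda(f)=\prod_{v\in V(G)}\lambda_{f(v)}$ and $Z_\Lambda(G,H)=\sum_{f\in{\rm Hom}(G,H)}w_\Lambda(f)$. Also $w_\Lambda(H)=\sum_{i\in V(H)}\lambda_i$. For $v\in V(G)$, $d(v)$ is the degree of $v$ in $G$. $K_{a,b}$ is the complete bipartite graph with partition classes of sizes $a$ and $b$ (for $a=0$ it consists of $b$ isolated vertices). *)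

(* Defs.v *)
From mathcomp Require Import all_boot all_order all_algebra.
From mathcomp Require Import all_classical all_reals all_analysis.

Set Implicit Arguments.
Unset Strict Implicit.
Unset Printing Implicit Defensive.

Import Order.TTheory GRing.Theory Num.Theory.
Local Open Scope ring_scope.

(* A finite graph without multiple edges in which loops are allowed. *)
Record graph := Graph {
  vertex :> finType;
  adj : rel vertex;
  adj_sym : symmetric adj
}.

Definition loopless (G : graph) : Prop := irreflexive (@adj G).

Definition degree (G : graph) (v : G) : nat := #|[set u : G | adj v u]|.

Definition bipartition (G : graph) (E O : {set G}) : Prop :=
  [/\ E :|: O = [set: G]%SET, [disjoint E & O] &
      forall u v : G, adj u v ->
        (u \in E /\ v \in O) \/ (u \in O /\ v \in E)].

Definition complete_bipartite_adj (a b : nat) : rel ('I_a + 'I_b)%type :=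
  fun x y => match x, y with
             | inl _, inr _ | inr _, inl _ => true
             | _, _ => false
             end.

Lemma complete_bipartite_adj_sym (a b : nat) :
  symmetric (@complete_bipartite_adj a b).
Proof. by move=> [x|x] [y|y]. Qed.

Definition complete_bipartite (a b : nat) : graph :=
  Graph (@complete_bipartite_adj_sym a b).

Definition Hom (G H : graph) : {set {ffun G -> H}} :=
  [set f : {ffun G -> H} |
    [forall u : G, [forall v : G, adj u v ==> adj (f u) (f v)]]].

Definition hom_weight (R : realType) (G H : graph) (lam : H -> R)
    (f : {ffun G -> H}) : R :=
  \prod_(v : G) lam (f v).

Definition partition_function (R : realType) (G H : graph) (lam : H -> R) : R :=
  \sum_(f in Hom G H) hom_weight lam f.

Definition total_weight (R : realType) (H : graph) (lam : H -> R) : R :=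
  \sum_(i : H) lam i.

(* Main.v *)
Require Import Defs.
From mathcomp Require Import all_boot all_order all_algebra.
From mathcomp Require Import all_classical all_reals all_analysis.

(** Split a homomorphism from [G] to [H] into its restriction to [E] and its
    values on [O].  Once the restriction [x] is chosen, the vertices [v] of [O]
    choose their images independently, and the admissible images of [v] have
    total weight [g_v x], which depends only on the values of [x] on the
    neighbourhood of [v].  Hence
      [Z(G, H) = sum_x (prod_(w in E) lam (x w)) * prod_(v in O) g_v x]
    ([partition_function_bipartite]).  Applied to the graph [K_(n,d)], in which
    all [d] vertices of the second class have the same neighbourhood, this
    reads [Z(K_(n,d), H) = sum_x (prod lam (x w)) * (g x) ^ d], so that
    [Z(K_(d(v),d), H) ^ (1/d)] is the L^d norm of [g_v] for the product of the
    measures [lam].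

    The theorem is therefore a Finner-type inequality ([finner]): it bounds the
    integral of a product of functions [g_v], each depending on some of the
    coordinates, by the product of their L^d norms.  Summing over one
    coordinate [w] at a time, it reduces to a Hoelder inequality on [H]
    ([holder]) for the functions that involve the coordinate [w]; there are
    [d(w)] of them.  When [d(w) = d] this is the classical inequality.  When
    [d(w) > d] it still holds because all atoms of the measure have mass at
    least 1: a normalised function is then at most 1 everywhere, so that
    surplus factors may be discarded.  When [d(w) < d], bounding all factors by
    1 costs the total mass of the measure, which is the factor [w_lam(H)]
    attached to each vertex of [E] of degree less than [d]. *)

Set Implicit Arguments.
Unset Strict Implicit.
Unset Printing Implicit Defensive.

Import Order.TTheory GRing.Theory Num.Theory.
Local Open Scope ring_scope.


(** * A Hoelder inequality on measures with atoms of mass at least 1 *)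

Lemma powR_invnK (R : realType) (d : nat) (a : R) : (0 < d)%N -> 0 <= a ->
  (a `^ d%:R^-1) ^+ d = a.
Proof.
move=> d0 a0; rewrite -powR_mulrn ?powR_ge0// -powRrM mulVf ?powRr1//.
by rewrite pnatr_eq0 -lt0n.
Qed.

Lemma powR_invn_le1 (R : realType) (d : nat) (a : R) : 0 <= a <= 1 -> a `^ d%:R^-1 <= 1.
Proof.
case/andP=> a0 a1; rewrite -[leRHS](congr1 (@^~ d%:R^-1) (powR1 R)).
by apply: ge0_ler_powR; rewrite ?invr_ge0 ?ler0n ?nnegrE.
Qed.

Lemma prod_le1_subset (R : realType) (I : finType) (A B : {set I}) (a : I -> R) :
  B \subset A -> {in A, forall i, 0 <= a i <= 1} ->
  \prod_(i in A) a i <= \prod_(i in B) a i.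
Proof.
move=> BA a01; rewrite [leLHS]big_mkcond [leRHS]big_mkcond /=.
apply: ler_prod => i _; case: ifP => iA; last first.
  by case: ifP => [/(fintype.subsetP BA)|_]; rewrite ?iA// ler01 lexx.
have /andP[ai0 ai1] := a01 i iA.
by case: ifP => _; rewrite ai0 ?lexx.
Qed.

(** The arithmetic-geometric mean inequality for exactly [d] factors. *)
Lemma prod_powR_le_mean (R : realType) (I : finType) (B : {set I}) (d : nat)
    (a : I -> R) :
  (0 < d)%N -> #|B| = d -> (forall i, 0 <= a i) ->
  \prod_(i in B) a i `^ d%:R^-1 <= (\sum_(i in B) a i) / d%:R.
Proof.
move=> d0 Bd a0.
rewrite -(@ler_pXn2r _ d)// ?nnegrE ?prodr_ge0 ?divr_ge0 ?sumr_ge0//; first last.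
  by move=> i _; exact: powR_ge0.
rewrite -prodrXl (eq_bigr a) => [|i _]; last by rewrite powR_invnK.
have [] := @leif_AGM _ _ (mem B) a => //.
by rewrite Bd.
Qed.

Section WeightedHolder.
Variables (R : realType) (S : finType) (lam : S -> R).
Hypothesis lam_ge1 : forall i, 1 <= lam i.

Let lam_gt0 i : 0 < lam i.
Proof. exact: lt_le_trans ltr01 (lam_ge1 i). Qed.

(** Since every atom has mass at least 1, a nonnegative function of integral 1
    is bounded by 1.  With fewer than [d] factors the product is thus at most
    1; with at least [d] factors, keep [d] of them and use the
    arithmetic-geometric mean inequality. *)
Lemma holder_normalized (I : finType) (A : {set I}) (d : nat) (a : I -> S -> R) :
  (0 < d)%N -> (forall v i, 0 <= a v i) ->
  (forall v, v \in A -> \sum_i lam i * a v i = 1) ->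
  \sum_i lam i * \prod_(v in A) a v i `^ d%:R^-1 <=
    (\sum_i lam i) ^+ (#|A| < d)%N.
Proof.
move=> d0 a0 a1.
have a01 v i : v \in A -> 0 <= a v i <= 1.
  move=> vA; rewrite a0 /= -(a1 v vA) (bigD1 i)//=.
  apply: le_trans (ler_wpDr (sumr_ge0 _ _) (lexx _)).
    by rewrite ler_peMl.
  by move=> j _; rewrite mulr_ge0// ltW.
case: ltnP => [_|dA].
  rewrite expr1; apply: ler_sum => i _; rewrite ler_piMr ?(ltW (lam_gt0 _))//.
  rewrite -[leRHS](finset.big_set0 1 *%R (fun v => a v i `^ d%:R^-1)).
  apply: prod_le1_subset => [|v vA]; first exact: finset.sub0set.
  by rewrite powR_ge0 powR_invn_le1// a01.
rewrite expr0.
have [B BA Bd] : exists2 B : {set I}, B \subset A & #|B| = d.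
  exists [set x in take d (enum A)]%SET.
    by apply/fintype.subsetP => x; rewrite inE => /mem_take; rewrite mem_enum.
  rewrite cardsE (card_uniqP _) ?take_uniq ?enum_uniq//.
  by rewrite size_takel// -cardE.
apply: (@le_trans _ _ (\sum_i lam i * ((\sum_(v in B) a v i) / d%:R))).
  apply: ler_sum => i _; rewrite ler_wpM2l ?(ltW (lam_gt0 _))//.
  apply: le_trans (prod_powR_le_mean d0 Bd (a0 ^~ i)).
  apply: prod_le1_subset => // v vA.
  by rewrite powR_ge0 powR_invn_le1// a01.
under eq_bigr => i _ do rewrite mulrA mulr_sumr.
rewrite -mulr_suml exchange_big /= (eq_bigr (fun=> 1)) => [|v vB]; last first.
  by rewrite a1// (fintype.subsetP BA).
by rewrite sumr_const Bd divff// pnatr_eq0 -lt0n.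
Qed.

(** The functions are given through their [d]-th powers [h v].  The exponent on
    the right is a boolean: the total mass is paid only when there are fewer
    than [d] factors. *)
Lemma holder (I : finType) (A : {set I}) (d : nat) (h : I -> S -> R) :
  (0 < d)%N -> (forall v i, 0 <= h v i) ->
  \sum_i lam i * \prod_(v in A) h v i `^ d%:R^-1 <=
    (\sum_i lam i) ^+ (#|A| < d)%N *
    \prod_(v in A) (\sum_i lam i * h v i) `^ d%:R^-1.
Proof.
move=> d0 h0; pose M v := \sum_i lam i * h v i.
have M0 v : 0 <= M v by apply: sumr_ge0 => i _; rewrite mulr_ge0 ?(ltW (lam_gt0 _)).
(* A function of norm 0 vanishes identically, as the atoms have positive mass;
   all others are normalised. *)
have [/existsP[v /andP[vA /eqP Mv]]|Mn0] := boolP [exists v, (v \in A) && (M v == 0)].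
  rewrite big1 ?mulr_ge0 ?prodr_ge0 ?exprn_ge0 ?sumr_ge0//.
  - by move=> i _; exact: ltW.
  - by move=> u _; exact: powR_ge0.
  move=> i _; rewrite (bigD1 v)//=.
  have /eqP : lam i * h v i = 0.
    have := @psumr_eq0P _ _ xpredT (fun i => lam i * h v i); apply => //.
    by move=> j _; rewrite mulr_ge0 ?(ltW (lam_gt0 _)).
  rewrite mulf_eq0 gt_eqF//= => /eqP->.
  by rewrite powR0 ?mul0r ?mulr0// invr_eq0 pnatr_eq0 -lt0n.
have Mp v : v \in A -> M v != 0.
  by move=> vA; move/existsPn/(_ v): Mn0; rewrite vA.
have -> : \sum_i lam i * \prod_(v in A) h v i `^ d%:R^-1 =
    (\sum_i lam i * \prod_(v in A) (h v i / M v) `^ d%:R^-1) *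
    \prod_(v in A) M v `^ d%:R^-1.
  rewrite mulr_suml; apply: eq_bigr => i _.
  rewrite -mulrA -big_split /=; congr (_ * _); apply: eq_bigr => v vA.
  by rewrite -powRM ?divr_ge0// divfK// Mp.
rewrite ler_wpM2r ?prodr_ge0//; first by move=> v _; exact: powR_ge0.
apply: holder_normalized => // [v i|v vA]; first by rewrite divr_ge0.
under eq_bigr => i _ do rewrite mulrA.
by rewrite -mulr_suml divff// Mp.
Qed.

End WeightedHolder.

(** * Iterated weighted sums *)

Definition update (T S : finType) (x : {ffun T -> S}) (w : T) (i : S) :
    {ffun T -> S} :=
  [ffun u => if u == w then i else x u].

Definition depends_only (T S : finType) (V : Type) (D : pred T)
    (F : {ffun T -> S} -> V) : Prop :=
  forall x y : {ffun T -> S}, {in D, x =1 y} -> F x = F y.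

Section IteratedSum.
Variables (R : realType) (S : finType) (lam : S -> R) (T : finType).
Implicit Types (x y : {ffun T -> S}) (s t : seq T) (F : {ffun T -> S} -> R).

(** Integration of [F] against [lam] in each of the coordinates listed in [s];
    the other coordinates are read from [x]. *)
Fixpoint wsum s F x : R :=
  if s is w :: s' then \sum_i lam i * wsum s' F (update x w i) else F x.

(** The same integral for a function of a list of [n] values.  It does not
    refer to the set of coordinates, which makes integrals over the
    neighbourhoods of vertices in two different graphs comparable. *)
Fixpoint lsum (n : nat) (Phi : seq S -> R) : R :=
  if n is n'.+1 then \sum_i lam i * lsum n' (fun l => Phi (i :: l))
  else Phi [::].

Lemma update_in D x w i : ~~ D w -> {in D, update x w i =1 x}.
Proof.
move=> Dw u uD; rewrite ffunE; case: eqP => // uw.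
by move: uD; rewrite uw unfold_in (negbTE Dw).
Qed.

Lemma eq_wsum s F F' x :
  (forall y, {in [predC s], y =1 x} -> F y = F' y) -> wsum s F x = wsum s F' x.
Proof.
elim: s x => [|w s IH] x FF' /=; first exact: FF'.
apply: eq_bigr => i _; congr (_ * _); apply: IH => y yx; apply: FF' => u.
rewrite !inE negb_or => /andP[uw us].
by rewrite yx ?inE// ffunE (negbTE uw).
Qed.

Lemma wsum_cat s t F x : wsum (s ++ t) F x = wsum s (wsum t F) x.
Proof. by elim: s x => //= w s IH x; apply: eq_bigr => i _; rewrite IH. Qed.

Lemma wsum_depends s F D : depends_only D F -> depends_only D (wsum s F).
Proof.
move=> DF; elim: s => [|w s IH] x y xy /=; first exact: DF.
apply: eq_bigr => i _; congr (_ * _); apply: IH => u uD.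
by rewrite !ffunE; case: eqP => // _; exact: xy.
Qed.

Lemma wsum_pull s D (K F : {ffun T -> S} -> R) x :
  depends_only D K -> {in s, forall w, ~~ D w} ->
  wsum s (fun y => K y * F y) x = K x * wsum s F x.
Proof.
move=> DK; elim: s x => //= w s IH x sD.
rewrite mulr_sumr; apply: eq_bigr => i _.
rewrite IH => [|u us]; last by rewrite sD// inE us orbT.
by rewrite (DK _ _ (update_in _ _ (sD w (mem_head _ _)))) mulrCA.
Qed.

(** Fubini for a product in which each factor involves only its own
    coordinate among those that are summed. *)
Lemma wsum_prod t (K : T -> {ffun T -> S} -> R) (D : T -> pred T) x :
  uniq t -> (forall v, depends_only (D v) (K v)) ->
  {in t &, forall u v, u != v -> ~~ D v u} ->
  wsum t (fun y => \prod_(v <- t) K v y) x = \prod_(v <- t) wsum [:: v] (K v) x.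
Proof.
move=> + DK; elim: t x => [|v t IH] x /=; first by rewrite !big_nil.
case/andP=> vt ut tD; rewrite big_cons mulr_suml; apply: eq_bigr => i _.
under [wsum _ _ _]eq_wsum do rewrite big_cons.
rewrite (wsum_pull _ _ (DK v)) => [|u us]; last first.
  by apply: tD; rewrite ?inE ?us ?eqxx ?orbT//; apply: contraNneq vt => <-.
rewrite IH// => [|u w us ws]; last by apply: tD; rewrite inE ?us ?ws orbT.
rewrite -mulrA; congr (_ * (_ * _)).
rewrite !big_seq; apply: eq_bigr => u us.
apply: (@wsum_depends [:: u] _ _ (DK u)); apply: update_in.
by apply: tD; rewrite ?inE ?us ?eqxx ?orbT//; apply: contraNneq vt => ->.
Qed.

Lemma wsum_map s (Phi : seq S -> R) x : uniq s ->
  wsum s (fun y => Phi (map y s)) x = lsum (size s) Phi.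
Proof.
elim: s Phi x => //= w s IH Phi x /andP[ws us]; apply: eq_bigr => i _.
congr (_ * _); rewrite -(IH (fun l => Phi (i :: l)) (update x w i) us).
by apply: eq_wsum => y yx; rewrite yx ?inE// ffunE eqxx.
Qed.

Lemma wsum_sum s F x : uniq s ->
  \sum_(y : {ffun T -> S} | [forall u, (u \notin s) ==> (y u == x u)])
    (\prod_(w <- s) lam (y w)) * F y = wsum s F x.
Proof.
elim: s x => [|w s IH] x /=.
  move=> _; rewrite (big_pred1 x) => [|y]; first by rewrite big_nil mul1r.
  apply/forallP/eqP => [yx|->] /=; last by move=> u; rewrite eqxx.
  by apply/ffunP => u; apply/eqP; exact: yx.
case/andP=> ws us; rewrite (partition_big (fun y : {ffun T -> S} => y w) predT)//=.
apply: eq_bigr => i _; rewrite -IH// mulr_sumr.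
apply: eq_big => [y|y /andP[_ /eqP yw]]; last by rewrite big_cons yw mulrA.
apply/andP/forallP => [[/forallP yx /eqP yw] u|yx].
  apply/implyP => us'; rewrite ffunE; have [->|uw] := eqVneq u w; first by rewrite yw.
  by apply: (implyP (yx u)); rewrite inE negb_or uw.
split; last by move/implyP/(_ ws): (yx w); rewrite ffunE eqxx.
apply/forallP => u; apply/implyP; rewrite inE negb_or => /andP[uw us'].
by move/implyP/(_ us'): (yx u); rewrite ffunE (negbTE uw).
Qed.

Hypothesis lam_ge1 : forall i, 1 <= lam i.

Let lam_ge0 i : 0 <= lam i.
Proof. exact: le_trans ler01 (lam_ge1 i). Qed.

Lemma wsum_ge0 s F x : (forall y, 0 <= F y) -> 0 <= wsum s F x.
Proof.
by move=> F0; elim: s x => //= w s IH x; apply: sumr_ge0 => i _; rewrite mulr_ge0.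
Qed.

(** Integrate one coordinate [w] at a time, by induction on [s].  In the bound
    obtained for the remaining coordinates, the factors with [~~ N v w] do not
    depend on coordinate [w] and come out of the sum; [holder] applies to the
    others, and [w] contributes the total mass if there are fewer than [d] of
    them. *)
Lemma finner (I : finType) (A : {set I}) (N : I -> pred T)
    (F : I -> {ffun T -> S} -> R) (d : nat) s x : (0 < d)%N ->
  (forall v y, 0 <= F v y) -> (forall v, depends_only (N v) (F v)) ->
  wsum s (fun y => \prod_(v in A) F v y) x <=
    (\sum_i lam i) ^+ count (fun w => #|[set v in A | N v w]| < d)%N s *
    \prod_(v in A)
      wsum ([seq u <- s | N v u]) (fun y => F v y ^+ d) x `^ d%:R^-1.
Proof.
move=> d0 F0 NF; set W := \sum_i lam i.
have W0 : 0 <= W by apply: sumr_ge0.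
pose h s v y := wsum ([seq u <- s | N v u]) (fun y => F v y ^+ d) y.
have h0 t v y : 0 <= h t v y by apply: wsum_ge0 => z; exact: exprn_ge0.
elim: s x => [|w s IH] x /=.
  rewrite expr0 mul1r; apply: ler_prod => v _; rewrite F0 /=.
  rewrite -powR_mulrn// -powRrM mulfV ?powRr1//.
  by rewrite pnatr_eq0 -lt0n.
set c := count _ s; pose B := [set v in A | N v w]%SET.
rewrite -/B.
apply: (@le_trans _ _ (\sum_i lam i *
   (W ^+ c * \prod_(v in A) h s v (update x w i) `^ d%:R^-1))).
  by apply: ler_sum => i _; rewrite ler_wpM2l.
have split_prod (a : I -> R) :
    \prod_(v in A) a v = \prod_(v in A | ~~ N v w) a v * \prod_(v in B) a v.
  rewrite (bigID (fun v => N v w)) /= mulrC; congr (_ * _).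
  by apply: eq_bigl => v; rewrite inE.
rewrite (eq_bigr (fun i => W ^+ c * \prod_(v in A | ~~ N v w) h s v x `^ d%:R^-1
    * (lam i * \prod_(v in B) h s v (update x w i) `^ d%:R^-1))); last first.
  move=> i _; rewrite split_prod mulrCA -!mulrA; congr (_ * _).
  rewrite mulrCA; congr (_ * _); apply: eq_bigr => v /andP[_ Nvw].
  congr (_ `^ _); apply: (@wsum_depends _ _ (N v)); last exact: update_in.
  by move=> y z yz; rewrite (NF v y z).
rewrite -mulr_sumr [X in _ <= _ * X]split_prod.
rewrite [X in _ <= _ * (X * _)](eq_bigr (fun v => h s v x `^ d%:R^-1)); last first.
  by move=> v /andP[_ /negbTE Nvw]; rewrite Nvw.
rewrite [X in _ <= _ * (_ * X)](eq_bigr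
    (fun v => (\sum_i lam i * h s v (update x w i)) `^ d%:R^-1)); last first.
  by move=> v; rewrite inE => /andP[_ ->].
set P := \prod_(v in A | _) _; rewrite exprD (mulrC (W ^+ (_ < d)%N)) mulrACA.
rewrite ler_wpM2l ?holder// mulr_ge0 ?exprn_ge0//.
by apply: prodr_ge0 => v _; exact: powR_ge0.
Qed.
End IteratedSum.

(** * Partition functions of bipartite graphs *)

(** The total weight of the images available to a vertex whose neighbours are
    mapped to the elements of [l]. *)
Definition nbr_weight (R : realType) (H : graph) (lam : H -> R) (l : seq H) : R :=
  \sum_(j : H) lam j * (all (adj j) l)%:R.

Lemma prod_natrb (R : realType) (I : Type) (r : seq I) (b : pred I) :
  \prod_(i <- r) (b i)%:R = (all b r)%:R :> R.
Proof.
by elim: r => [|i r IH]; rewrite ?big_nil// big_cons IH -natrM mulnb.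
Qed.

Lemma Hom_bipartite (G H : graph) (E O : {set G}) (f : {ffun G -> H}) :
  bipartition E O ->
  (f \in Defs.Hom G H) =
    all (fun v => all (adj (f v)) (map f [seq u <- enum E | adj v u])) (enum O).
Proof.
case=> _ _ EO; rewrite inE; apply/forallP/allP => [fH v _|fH u].
  apply/allP => _ /mapP[u + ->]; rewrite mem_filter => /andP[vu _].
  by move/forallP/(_ u): (fH v); rewrite vu.
have fadj a b : a \in O -> b \in E -> adj a b -> adj (f a) (f b).
  move=> aO bE ab; have := fH a; rewrite mem_enum => /(_ aO)/allP; apply.
  by rewrite map_f// mem_filter ab mem_enum.
apply/forallP => v; apply/implyP => uv; case: (EO u v uv) => -[] uX vX.
  by rewrite adj_sym; apply: fadj => //; rewrite adj_sym.
exact: fadj.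
Qed.

(** Sum over the images of the vertices of [O] first: given the images of the
    vertices of [E], the constraints at distinct vertices of [O] are
    independent. *)
Lemma partition_function_bipartite (R : realType) (G H : graph) (lam : H -> R)
    (E O : {set G}) (x : {ffun G -> H}) : bipartition E O ->
  partition_function G lam =
  wsum lam (enum E) (fun y =>
    \prod_(v in O) nbr_weight lam (map y [seq u <- enum E | adj v u])) x.
Proof.
move=> bip; have [EOT EOD _] := bip.
pose K v (y : {ffun G -> H}) : R :=
  (all (adj (y v)) (map y [seq u <- enum E | adj v u]))%:R.
have nE v : v \in O -> v \notin E.
  by move=> vO; apply: contraL vO => vE; rewrite (disjointFr EOD vE).
have inEO u : (u \in E) || (u \in O).
  by rewrite -finset.in_setU EOT finset.in_setT.
have -> : partition_function G lam =
    wsum lam (enum E ++ enum O) (fun y => \prod_(v <- enum O) K v y) x.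
  rewrite -wsum_sum; last first.
    rewrite cat_uniq !enum_uniq andbT /=; apply/hasPn => v.
    by rewrite !mem_enum; exact: nE.
  rewrite /partition_function [LHS]big_mkcond [RHS]big_mkcond /=.
  apply: eq_bigr => f _; rewrite [in RHS]ifT; last first.
    apply/forallP => u; apply/implyP; rewrite mem_cat !mem_enum.
    by rewrite inEO.
  rewrite prod_natrb -Hom_bipartite//; case: ifP; rewrite ?mulr1 ?mulr0// => _.
  rewrite /hom_weight; apply: perm_big.
  apply: uniq_perm; rewrite ?index_enum_uniq//.
    rewrite cat_uniq !enum_uniq andbT /=; apply/hasPn => v.
    by rewrite !mem_enum; exact: nE.
  by move=> u; rewrite mem_index_enum mem_cat !mem_enum inEO.
rewrite wsum_cat; apply: eq_wsum => y _.
rewrite (@wsum_prod _ _ _ _ _ K (fun v => [pred u | (u == v) || (u \in E)]))//.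
- rewrite big_enum; apply: eq_bigr => v vO /=; apply: eq_bigr => j _.
  congr (_ * _); rewrite /K ffunE eqxx; congr (all _ _)%:R.
  apply/eq_in_map => u; rewrite mem_filter mem_enum ffunE => /andP[_ uE].
  by case: eqP uE => // ->; rewrite (negbTE (nE v vO)).
- exact: enum_uniq.
- move=> v y1 y2 y12; rewrite /K y12 ?inE ?eqxx//; congr (all _ _)%:R.
  apply/eq_in_map => u; rewrite mem_filter mem_enum => /andP[_ uE].
  by rewrite y12// inE uE orbT.
- move=> u v; rewrite !mem_enum => uO vO uv /=.
  by rewrite negb_or uv nE.
Qed.

(** The [b] vertices of the second class have the same neighbourhood, the whole
    first class, hence the [b]-th power. *)
Lemma partition_function_complete_bipartite (R : realType) (H : graph)
    (lam : H -> R) (h0 : H) (a b : nat) :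
  partition_function (complete_bipartite a b) lam =
  lsum lam a (fun l => nbr_weight lam l ^+ b).
Proof.
pose G := complete_bipartite a b.
pose E : {set G} := finset.imset (inl : 'I_a -> G) (mem 'I_a).
pose O : {set G} := finset.imset (inr : 'I_b -> G) (mem 'I_b).
have cE : #|E| = a by rewrite card_imset ?card_ord// => i j [].
have cO : #|O| = b by rewrite card_imset ?card_ord// => i j [].
have iE i : (inl i : G) \in E by apply: imset_f.
have iO i : (inr i : G) \in O by apply: imset_f.
have bip : bipartition E O.
  split.
  - by apply/setP => -[i|i]; rewrite finset.in_setU finset.in_setT ?iE ?iO ?orbT.
  - rewrite disjoint_subset; apply/fintype.subsetP => _ /imsetP[i _ ->].
    by rewrite inE; apply/imsetP => -[].
  - by move=> [i|i] [j|j] // _; [left|right]; rewrite ?iE ?iO.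
rewrite (partition_function_bipartite _ [ffun=> h0] bip) -[in RHS]cE cardE.
rewrite -(wsum_map _ _ [ffun=> h0]) ?enum_uniq//.
apply: eq_wsum => y _; rewrite (eq_bigr (fun=> nbr_weight lam (map y (enum E)))).
  by rewrite prodr_const cO.
move=> v /imsetP[i _ ->]; congr (nbr_weight _ (map _ _)); apply/all_filterP.
by apply/allP => u; rewrite mem_enum => /imsetP[j _ ->].
Qed.

(** * The upper bound *)

Lemma count_enum (T : finType) (A : {set T}) (P : pred T) :
  count P (enum A) = #|[set w in A | P w]|.
Proof.
rewrite -size_filter -(card_uniqP (filter_uniq _ (enum_uniq _))).
by apply: eq_card => w; rewrite mem_filter inE mem_enum andbC.
Qed.

Theorem theorem1p7 (R : realType) (H : graph) (lam : H -> R)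
    (lam_gt1 : forall i : H, 1 < lam i)
    (G : graph) (G_loopless : loopless G)
    (E O : {set G}) (EO_bipartition : bipartition E O)
    (leEO : (#|E| <= #|O|)%N)
    (d : nat) (d_gt0 : (0 < d)%N) :
  partition_function G lam <=
    total_weight lam ^+ #|[set w in E | (degree w < d)%N]| *
    \prod_(v in O)
      partition_function (complete_bipartite (degree v) d) lam `^ (d%:R^-1).
Proof.
have lam_ge1 i : 1 <= lam i by exact: ltW.
have W0 : 0 <= total_weight lam.
  by apply: sumr_ge0 => i _; apply: le_trans ler01 _.
(* The base point [x] of the iterated sums exists unless there is no map at all
   from [G] to [H], and then the left-hand side is 0. *)
have [x _|noHom] := pickP (fun _ : {ffun G -> H} => true); last first.
  rewrite /partition_function big1 => [|f]; last by have := noHom f.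
  rewrite mulr_ge0 ?exprn_ge0// prodr_ge0// => v _; exact: powR_ge0.
pose nw v (y : {ffun G -> H}) :=
  nbr_weight lam (map y [seq u <- enum E | adj v u]).
pose N (v : G) : pred G := fun u => (u \in E) && adj v u.
have nw0 v y : 0 <= nw v y.
  by apply: sumr_ge0 => j _; rewrite mulr_ge0 ?ler0n// (le_trans ler01).
have nwN v : depends_only (N v) (nw v).
  move=> y z yz; congr nbr_weight; apply/eq_in_map => u.
  by rewrite mem_filter mem_enum => /andP[vu uE]; rewrite yz// unfold_in /= /N uE.
have [_ EOD EO] := EO_bipartition.
have inO v u : v \in O -> adj v u -> u \in E.
  by move=> vO /EO[[vE]|[]//]; rewrite (disjointFr EOD vE) in vO.
rewrite (partition_function_bipartite _ x EO_bipartition).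
apply: le_trans (finner lam_ge1 O (enum E) x d_gt0 nw0 nwN) _.
rewrite le_eqVlt; apply/orP; left; apply/eqP; congr (_ ^+ _ * _).
  rewrite count_enum; apply: eq_card => w; rewrite !inE.
  case wE: (w \in E) => //=; congr (_ < _)%N; apply: eq_card => v.
  rewrite !inE /N wE adj_sym andb_idl// => /EO[[]//|[wO]].
  by rewrite (disjointFr EOD wE) in wO.
apply: eq_bigr => v vO; congr (_ `^ _).
rewrite (partition_function_complete_bipartite _ (x v)).
have -> : degree v = size [seq u <- enum E | N v u].
  rewrite size_filter count_enum; apply: eq_card => u; rewrite !inE /N.
  by case vu: (adj v u); rewrite ?andbF// (inO v).
rewrite -(wsum_map _ _ x); last exact/filter_uniq/enum_uniq.
apply: eq_wsum => y _; congr (nbr_weight _ (map _ _) ^+ _).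
by apply: eq_in_filter => u; rewrite mem_enum /N => ->.
Qed.
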